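(* For every integer $n\geq 3$, there is no injective group homomorphism from the symmetric group $\mathcal{S}_n$ into the Riordan group $\mathcal{R}(\mathbb{C})$, and there is no injective group homomorphism from the dihedral group $\mathcal{D}_n$ of order $2n$ into $\mathcal{R}(\mathbb{C})$.
   Context: Riordan group: for a field $\mathbb{K}$, $\mathcal{R}(\mathbb{K})$ is the set of pairs $(g(t),f(t))$ of formal power series in $\mathbb{K}[[t]]$ with $g(0)\neq 0$, $f(0)=0$ and $f'(0)\neq 0$, with group operation $(g_1(t),f_1(t))*(g_2(t),f_2(t))=(g_1(t)\,g_2(f_1(t)),\,f_2(f_1(t)))$ and identity $(1,t)$. $\mathcal{S}_n$ is the group of all permutations of $\{1,\ldots,n\}$, and $\mathcal{D}_n\cong\langle r_1,r_2\mid r_1^2=r_2^2=1,\ (r_1r_2)^n=1\rangle$ has order $2n$. *)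

(* Defs.v *)
From HB Require Import structures.
From mathcomp Require Import all_boot all_order all_algebra all_fingroup.
From mathcomp Require Import all_solvable.
From mathcomp Require Import boolp.

Set Implicit Arguments.
Unset Strict Implicit.
Unset Printing Implicit Defensive.

Import GRing.Theory.

Local Open Scope ring_scope.

(* [a : fps K] stands for the series \sum_n a n * t^n; it carries no topology
   and none of the pointwise structures of [nat -> K] is used. *)
Definition fps (K : Type) : Type := nat -> K.

Section FormalPowerSeries.
Variable K : fieldType.
Implicit Types a b c : fps K.

Definition fps_one : fps K := fun n => (n == 0%N)%:R.

Definition fps_t : fps K := fun n => (n == 1%N)%:R.

Definition fps_mul a b : fps K :=
  fun n => \sum_(i < n.+1) a i * b (n - i)%N.

Definition fps_exp a (k : nat) : fps K := iter k (fps_mul a) fps_one.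

(* The composite a(b(t)), meaningful when b 0 = 0: then b^k has order at least
   k, so the terms with k > n do not contribute to the coefficient of t^n. *)
Definition fps_comp a b : fps K :=
  fun n => \sum_(k < n.+1) a k * fps_exp b k n.

(* Laws are transferred from {poly K} through congruence modulo t^N. *)
Definition fps_approx (N : nat) a (p : {poly K}) :=
  forall i, (i < N)%N -> a i = p`_i.

Lemma approx_poly N a : fps_approx N a (\poly_(i < N) a i).
Proof. by move=> i ltiN; rewrite coef_poly ltiN. Qed.

Lemma approx_one N : fps_approx N fps_one 1.
Proof. by move=> i _; rewrite coef1. Qed.

Lemma approx_t N : fps_approx N fps_t 'X.
Proof. by move=> i _; rewrite coefX. Qed.

Lemma approx_mul N a b p q :
  fps_approx N a p -> fps_approx N b q -> fps_approx N (fps_mul a b) (p * q).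
Proof.
move=> ap bq i ltiN; rewrite coefM; apply: eq_bigr => j _.
rewrite ap ?bq //; first by apply: leq_ltn_trans ltiN; rewrite leq_subr.
by apply: leq_ltn_trans ltiN; rewrite -ltnS.
Qed.

Lemma approx_exp N a p k :
  fps_approx N a p -> fps_approx N (fps_exp a k) (p ^+ k).
Proof.
move=> ap; elim: k => [|k IHk]; first by rewrite expr0; apply: approx_one.
by rewrite exprS; apply: approx_mul.
Qed.

Lemma coef_exp_lt (q : {poly K}) k i : q`_0 = 0 -> (i < k)%N -> (q ^+ k)`_i = 0.
Proof.
move=> q0; elim: k i => // k IHk i ltik.
rewrite exprS coefM big1 // => -[[|j] /= ltji] _; first by rewrite q0 mul0r.
case: i ltik ltji => // i ltik ltji.
by rewrite IHk ?mulr0 // subSS (leq_ltn_trans (leq_subr _ _)).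
Qed.

Lemma approx_comp N a b p q : b 0%N = 0 ->
  fps_approx N a p -> fps_approx N b q -> fps_approx N (fps_comp a b) (p \Po q).
Proof.
move=> b0 ap bq i ltiN; have q0 : q`_0 = 0 by rewrite -bq ?(leq_ltn_trans _ ltiN).
rewrite coef_comp_poly /fps_comp.
transitivity (\sum_(k < i.+1) p`_k * (q ^+ k)`_i).
  apply: eq_bigr => k _; rewrite ap ?(approx_exp _ bq) //.
  by apply: leq_ltn_trans ltiN; rewrite -ltnS.
have widen m : (m <= i.+1 + size p)%N ->
    (forall k, (m <= k)%N -> p`_k * (q ^+ k)`_i = 0) ->
  \sum_(k < m) p`_k * (q ^+ k)`_i =
  \sum_(k < i.+1 + size p) p`_k * (q ^+ k)`_i.
  move=> lem z; rewrite (big_ord_widen _ (fun k => p`_k * (q ^+ k)`_i) lem).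
  rewrite [RHS](bigID (fun k : 'I__ => (k < m)%N)) /= [X in _ + X]big1 ?addr0 //.
  by move=> k; rewrite -leqNgt => /z.
rewrite !widen ?leq_addr ?leq_addl // => k lek.
  by rewrite nth_default ?mul0r.
by rewrite coef_exp_lt ?mulr0.
Qed.

Lemma approx_eq a b :
  (forall N, exists p, fps_approx N a p /\ fps_approx N b p) -> a = b.
Proof.
by move=> ab; apply: funext => n; have [p [-> // ->]] := ab n.+1.
Qed.

Lemma fps_comp0 a b : fps_comp a b 0%N = a 0%N.
Proof. by rewrite /fps_comp big_ord1 mulr1. Qed.

Lemma fps_mul0 a b : fps_mul a b 0%N = a 0%N * b 0%N.
Proof. by rewrite /fps_mul big_ord1 subn0. Qed.

Lemma fps_expS1 a : fps_exp a 1 = a.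
Proof.
apply: approx_eq => N; exists (\poly_(i < N) a i); split; last exact: approx_poly.
by rewrite -[X in fps_approx _ _ X]expr1; apply/approx_exp/approx_poly.
Qed.

Lemma fps_comp1 a b : b 0%N = 0 -> fps_comp a b 1%N = a 1%N * b 1%N.
Proof.
move=> b0; rewrite /fps_comp big_ord_recr big_ord1 fps_expS1 /=.
by rewrite [X in X + _](_ : _ = 0) ?add0r //; apply: mulr0.
Qed.

Lemma fps_mulA : associative fps_mul.
Proof.
move=> a b c; apply: approx_eq => N.
exists (\poly_(i < N) a i * \poly_(i < N) b i * \poly_(i < N) c i); split.
  by rewrite -mulrA; do !apply: approx_mul; apply: approx_poly.
by do !apply: approx_mul; apply: approx_poly.
Qed.

Lemma fps_mul1s : left_id fps_one fps_mul.
Proof.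
move=> a; apply: approx_eq => N; exists (\poly_(i < N) a i).
split; last exact: approx_poly.
rewrite -[X in fps_approx _ _ X]mul1r.
by apply: approx_mul; [apply: approx_one | apply: approx_poly].
Qed.

Lemma fps_muls1 : right_id fps_one fps_mul.
Proof.
move=> a; apply: approx_eq => N; exists (\poly_(i < N) a i).
split; last exact: approx_poly.
rewrite -[X in fps_approx _ _ X]mulr1.
by apply: approx_mul; [apply: approx_poly | apply: approx_one].
Qed.

Lemma fps_mulC : commutative fps_mul.
Proof.
move=> a b; apply: approx_eq => N.
exists (\poly_(i < N) a i * \poly_(i < N) b i); split; last rewrite mulrC;
  by apply: approx_mul; apply: approx_poly.
Qed.

Lemma fps_compMl a b c : c 0%N = 0 ->
  fps_comp (fps_mul a b) c = fps_mul (fps_comp a c) (fps_comp b c).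
Proof.
move=> c0; apply: approx_eq => N.
pose P (u : fps K) := \poly_(i < N) u i.
exists ((P a * P b) \Po P c); split; last rewrite comp_polyM.
  by apply: approx_comp => //; first apply: approx_mul; apply: approx_poly.
by apply: approx_mul; apply: approx_comp => //; apply: approx_poly.
Qed.

Lemma fps_compA a b c : b 0%N = 0 -> c 0%N = 0 ->
  fps_comp a (fps_comp b c) = fps_comp (fps_comp a b) c.
Proof.
move=> b0 c0; apply: approx_eq => N.
pose P (u : fps K) := \poly_(i < N) u i.
exists (P a \Po (P b \Po P c)); split; last rewrite comp_polyA.
  apply: approx_comp; rewrite ?fps_comp0 //; first exact: approx_poly.
  by apply: approx_comp => //; apply: approx_poly.
apply: approx_comp => //; last exact: approx_poly.
by apply: approx_comp => //; apply: approx_poly.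
Qed.

Lemma fps_comps_t a : fps_comp a fps_t = a.
Proof.
apply: approx_eq => N; exists (\poly_(i < N) a i); split; last exact: approx_poly.
rewrite -[X in fps_approx _ _ X]comp_polyXr; apply: approx_comp => //.
  exact: approx_poly.
exact: approx_t.
Qed.

Lemma fps_comp_ts a : a 0%N = 0 -> fps_comp fps_t a = a.
Proof.
move=> a0; apply: approx_eq => N; exists (\poly_(i < N) a i).
split; last exact: approx_poly.
rewrite -[X in fps_approx _ _ X]comp_polyX; apply: approx_comp => //.
  exact: approx_t.
exact: approx_poly.
Qed.

Lemma fps_comp_1s a : a 0%N = 0 -> fps_comp fps_one a = fps_one.
Proof.
move=> a0; apply: approx_eq => N; exists 1; split; last exact: approx_one.
rewrite -[X in fps_approx _ _ X](comp_polyC 1 (\poly_(i < N) a i)).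
apply: approx_comp => //; last exact: approx_poly.
exact: approx_one.
Qed.

(* Solving a triangular system coefficient by coefficient. *)
Lemma fps_triangular_solve (k : K) (F : fps K -> fps K) c : k != 0 ->
    (forall a b n, (forall i, (i < n)%N -> a i = b i) ->
      F a n - k * a n = F b n - k * b n) ->
  exists a, F a = c.
Proof.
move=> k0 causal.
pose next (s : seq K) :=
  (c (size s) - (F (nth 0 s) (size s) - k * nth 0 s (size s))) / k.
pose pre n := iter n (fun s => rcons s (next s)) [::].
have size_pre n : size (pre n) = n by elim: n => //= n IHn; rewrite size_rcons IHn.
pose a n := next (pre n).
have preE n i : (i < n)%N -> nth 0 (pre n) i = a i.
  elim: n => // n IHn; rewrite ltnS leq_eqVlt /= nth_rcons size_pre.
  by case/predU1P=> [->|ltin]; rewrite ?ltnn ?eqxx // ltin IHn.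
exists a; apply: funext => n.
have E : F a n - k * a n = c n - k * a n.
  rewrite (causal a (nth 0 (pre n))) => [|i ltin]; last by rewrite preE.
  by rewrite /a /next size_pre [k * (_ / k)]mulrC divfK // subKr.
by rewrite -[LHS](subrK (k * a n)) E subrK.
Qed.

Lemma fps_inv_ex a : a 0%N != 0 -> exists b, fps_mul b a = fps_one.
Proof.
move=> a0.
have [||b bP] := @fps_triangular_solve (a 0%N) (fps_mul a) fps_one; last 1 first.
- by exists b; rewrite fps_mulC.
- by [].
move=> b c n bc; rewrite /fps_mul !big_ord_recl /= subn0.
rewrite ![a 0%N * _ + _]addrC !addrK; apply: eq_bigr => i _.
by rewrite bc //= /bump /= add1n; case: n i bc => [[] //|n] i _;
  rewrite subSS ltnS leq_subr.
Qed.

Lemma fps_exp_lt a k i : a 0%N = 0 -> (i < k)%N -> fps_exp a k i = 0.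
Proof.
move=> a0 ltik; rewrite (approx_exp k (@approx_poly i.+1 a)) //.
by rewrite coef_exp_lt // coef_poly.
Qed.

Lemma fps_expS a k : fps_exp a k.+1 = fps_mul a (fps_exp a k).
Proof. by []. Qed.

Lemma fps_exp_eq N a b k : (forall i, (i < N)%N -> a i = b i) ->
  forall i, (i < N)%N -> fps_exp a k i = fps_exp b k i.
Proof.
move=> ab i ltiN; have bP := @approx_poly N b.
by rewrite (approx_exp k bP) // (@approx_exp N a (\poly_(j < N) b j)) // => j ltj;
  rewrite ab // bP.
Qed.

Lemma fps_comp_inv_ex a : a 0%N = 0 -> a 1%N != 0 ->
  exists b, b 0%N = 0 /\ fps_comp a b = fps_t.
Proof.
move=> a0 a1.
pose shift b : fps K := fun n => if n is m.+1 then b m else 0.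
have [||b bP] := @fps_triangular_solve (a 1%N)
  (fun b n => fps_comp a (shift b) n.+1) (fun n => fps_t n.+1); last 1 first.
- exists (shift b); split=> //; apply: funext => -[|n]; first by rewrite fps_comp0.
  by have := congr1 (@^~ n) bP.
- by [].
move=> b c n bc; have term1 (u : fps K) : fps_comp a u n.+1 =
    \sum_(i < n) a i.+2 * fps_exp u i.+2 n.+1 + a 1%N * u n.+1.
  rewrite /fps_comp 2!big_ord_recl a0 mul0r add0r addrC.
  by congr (_ + _ * _); rewrite fps_expS1.
rewrite !term1 !addrK; apply: eq_bigr => i _; congr (_ * _).
have eqs j : (j < n.+1)%N -> shift b j = shift c j.
  by case: j => //= j; rewrite ltnS; apply: bc.
move: (i.+1) (ltn0Sn i) => k k_gt0.
rewrite !(fps_expS _ k) /fps_mul; apply: eq_bigr => -[[|j] /= ltj] _.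
  by rewrite !mul0r.
rewrite subSS; have [ejn|nejn] := eqVneq j n.
  by rewrite ejn subnn !fps_exp_lt ?mulr0.
have ltjn : (j < n)%N by rewrite ltn_neqAle nejn.
by rewrite bc // (fps_exp_eq k eqs) // ltnS leq_subr.
Qed.

End FormalPowerSeries.

Section RiordanGroup.
Variable K : fieldType.

(* For f = [rio_f], f'(0) is the coefficient f 1. *)
Record riordan : Type := Riordan {
  rio_g : fps K;
  rio_f : fps K;
  rio_g0 : rio_g 0%N != 0;
  rio_f0 : rio_f 0%N == 0;
  rio_f1 : rio_f 1%N != 0
}.

Lemma riordan_eq (x y : riordan) :
  rio_g x = rio_g y -> rio_f x = rio_f y -> x = y.
Proof.
case: x y => [g f g0 f0 f1] [h e h0 e0 e1] /= gh fe.
case: h / gh h0 => h0; case: e / fe e0 e1 => e0 e1.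
by congr Riordan; apply: bool_irrelevance.
Qed.

HB.instance Definition _ := gen_eqMixin riordan.
HB.instance Definition _ := gen_choiceMixin riordan.

Definition riordan_one : riordan :=
  @Riordan (fps_one K) (fps_t K) (oner_neq0 K) (eqxx 0) (oner_neq0 K).

Lemma riordan_mul_g0 (x y : riordan) :
  fps_mul (rio_g x) (fps_comp (rio_g y) (rio_f x)) 0%N != 0.
Proof. by rewrite fps_mul0 fps_comp0 mulf_neq0 ?rio_g0. Qed.

Lemma riordan_mul_f0 (x y : riordan) : fps_comp (rio_f y) (rio_f x) 0%N == 0.
Proof. by rewrite fps_comp0 rio_f0. Qed.

Lemma riordan_mul_f1 (x y : riordan) : fps_comp (rio_f y) (rio_f x) 1%N != 0.
Proof. by rewrite fps_comp1 ?mulf_neq0 ?rio_f1 //; apply/eqP/rio_f0. Qed.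

Definition riordan_mul (x y : riordan) : riordan :=
  @Riordan (fps_mul (rio_g x) (fps_comp (rio_g y) (rio_f x)))
           (fps_comp (rio_f y) (rio_f x))
           (riordan_mul_g0 x y) (riordan_mul_f0 x y) (riordan_mul_f1 x y).

Lemma riordan_mulA : associative riordan_mul.
Proof.
move=> x y z; have f0 w := eqP (rio_f0 w).
apply: riordan_eq => /=; last by rewrite fps_compA.
by rewrite fps_compMl // fps_mulA fps_compA.
Qed.

Lemma riordan_mul1x : left_id riordan_one riordan_mul.
Proof. by move=> x; apply: riordan_eq; rewrite /= fps_comps_t ?fps_mul1s. Qed.

Lemma riordan_mulx1 : right_id riordan_one riordan_mul.
Proof.
move=> x; have f0 := eqP (rio_f0 x).
by apply: riordan_eq; rewrite /= ?fps_comp_ts // fps_comp_1s // fps_muls1.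
Qed.

Lemma riordan_linv_ex (x : riordan) : exists y, riordan_mul y x = riordan_one.
Proof.
have [h [h0 hP]] := fps_comp_inv_ex (eqP (rio_f0 x)) (rio_f1 x).
have [|k kP] := @fps_inv_ex _ (fps_comp (rio_g x) h).
  by rewrite fps_comp0 rio_g0.
have k0 : k 0%N != 0.
  apply: contraTneq (oner_neq0 K) => k0.
  by have := congr1 (@^~ 0%N) kP; rewrite fps_mul0 k0 mul0r => /esym/eqP ->.
have h1 : h 1%N != 0.
  apply: contraTneq (oner_neq0 K) => h1.
  by have := congr1 (@^~ 1%N) hP; rewrite fps_comp1 // h1 mulr0 => /esym/eqP ->.
exists (@Riordan k h k0 (introT eqP h0) h1).
by apply: riordan_eq.
Qed.

Definition riordan_inv (x : riordan) : riordan := projT1 (cid (riordan_linv_ex x)).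

Lemma riordan_mulVx : left_inverse riordan_one riordan_inv riordan_mul.
Proof. by move=> x; rewrite /riordan_inv; case: cid. Qed.

Lemma riordan_mulxV : right_inverse riordan_one riordan_inv riordan_mul.
Proof.
move=> x; rewrite -[LHS]riordan_mul1x -(riordan_mulVx (riordan_inv x)).
by rewrite -riordan_mulA (riordan_mulA _ x) riordan_mulVx riordan_mul1x.
Qed.

HB.instance Definition _ := isGroup.Build riordan
  riordan_mulA riordan_mul1x riordan_mulx1 riordan_mulVx riordan_mulxV.

End RiordanGroup.

(* Main.v *)
(* The pair (g, f) |-> (g(0), f'(0)) is a homomorphism from the Riordan group to
   K^* x K^*.  In characteristic 0 its kernel is torsion-free: if g = 1 modulo
   t^m and f = t modulo t^(m+1), then multiplication adds the coefficients of
   t^m in g and of t^(m+1) in f, so these vanish for an element of finite order,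
   and m can be increased.  A commutator of elements of a finite subgroup lies
   in this kernel, so finite subgroups are abelian; but S_n and D_n are not. *)
From HB Require Import structures.
Require Import Defs.
From mathcomp Require Import all_boot all_order all_algebra all_fingroup.
From mathcomp Require Import all_solvable.
From mathcomp Require Import boolp reals complex.

Set Implicit Arguments.
Unset Strict Implicit.
Unset Printing Implicit Defensive.

Import GRing.Theory Num.Theory.

Section TruncatedSeries.
Local Open Scope ring_scope.
Variable K : fieldType.
Implicit Types a b c : fps K.

Lemma fps_comp_low a b c n : b 0%N = 0 -> c 0%N = 0 ->
    (forall i, (i < n)%N -> b i = c i) ->
  forall i, (i < n)%N -> fps_comp a b i = fps_comp a c i.
Proof.
move=> b0 c0 bc i ltin; apply: eq_bigr => k _; congr (_ * _).
exact: (fps_exp_eq k bc).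
Qed.

(* Only the linear term of [a] sees the coefficient of t^(n+1) in [b]. *)
Lemma fps_comp_next a b c n : b 0%N = 0 -> c 0%N = 0 ->
    (forall i, (i < n.+1)%N -> b i = c i) ->
  fps_comp a b n.+1 - a 1%N * b n.+1 = fps_comp a c n.+1 - a 1%N * c n.+1.
Proof.
move=> b0 c0 bc.
have split1 (u : fps K) : fps_comp a u n.+1 =
    \sum_(i < n) a i.+2 * fps_exp u i.+2 n.+1 + a 1%N * u n.+1.
  rewrite /fps_comp 2!big_ord_recl [X in X + _](_ : _ = 0); last exact: mulr0.
  by rewrite add0r addrC; congr (_ + _ * _); rewrite fps_expS1.
rewrite !split1 !addrK; apply: eq_bigr => i _; congr (_ * _).
move: (i.+1) (ltn0Sn i) => k k_gt0.
(* In b * b^k the new coefficient of t^(n+1) only meets the constant term of b^k, which is 0 because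
   k > 0. *)
rewrite !(fps_expS _ k) /fps_mul; apply: eq_bigr => -[[|j] /= ltj] _.
  by rewrite b0 c0 !mul0r.
rewrite subSS; have [ejn|nejn] := eqVneq j n.
  by rewrite ejn subnn !fps_exp_lt ?mulr0.
have ltjn : (j.+1 < n.+1)%N by rewrite ltnS ltn_neqAle nejn.
by rewrite bc // (fps_exp_eq k bc) // ltnS leq_subr.
Qed.

(** Compare [b] with t itself: substituting t changes nothing, and t has no term of degree n+2. *)
Lemma fps_comp_near_t a b n : (forall i, (i < n.+2)%N -> b i = fps_t K i) ->
  (forall i, (i < n.+2)%N -> fps_comp a b i = a i) /\
  fps_comp a b n.+2 = a n.+2 + a 1%N * b n.+2.
Proof.
move=> bt; have b0 : b 0%N = 0 by rewrite bt.
split=> [i lti|]; first by rewrite (fps_comp_low a b0 _ bt) ?fps_comps_t.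
have := fps_comp_next a b0 (erefl : fps_t K 0%N = 0) bt.
by rewrite fps_comps_t /fps_t /= mulr0 subr0 => /(canRL (subrK _)).
Qed.

Lemma fps_mul_near_one a b n :
    (forall i, (i <= n)%N -> a i = fps_one K i) ->
    (forall i, (i <= n)%N -> b i = fps_one K i) ->
  (forall i, (i <= n)%N -> fps_mul a b i = fps_one K i) /\
  fps_mul a b n.+1 = a n.+1 + b n.+1.
Proof.
have one0 : fps_one K 0 = 1 by [].
(* Stated for every m: it also yields the coefficients of degree at most n, by taking smaller m. *)
have step m u v : (forall i, (i <= m)%N -> u i = fps_one K i) ->
    (forall i, (i <= m)%N -> v i = fps_one K i) ->
    fps_mul u v m.+1 = u m.+1 + v m.+1.
  move=> u1 v1; rewrite /fps_mul big_ord_recl big_ord_recr /= subn0 subnn.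
  rewrite big1 => [|i _]; last by rewrite /= /bump add1n u1 ?mul0r.
  by rewrite u1 // (v1 0%N) // one0 mul1r add0r mulr1 addrC.
move=> a1 b1; split; last exact: step.
case=> [|i] lein; first by rewrite fps_mul0 a1 // b1 // mulr1.
rewrite step => [|j leji|j leji].
- by rewrite a1 // b1 // addr0.
- by rewrite a1 // ltnW // (leq_ltn_trans leji).
- by rewrite b1 // ltnW // (leq_ltn_trans leji).
Qed.

End TruncatedSeries.

Section FiniteSubgroups.
Local Open Scope ring_scope.
Variable K : fieldType.
Implicit Types x y z : riordan K.

(* [f] is controlled one order further than [g], so that substituting it leaves
   the coefficient of t^(n+1) in the other factor's [g] unchanged. *)
Definition riordan_near1 n z :=
  (forall i, (i <= n)%N -> rio_g z i = fps_one K i) /\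
  (forall i, (i <= n.+1)%N -> rio_f z i = fps_t K i).

Lemma riordan_near1M n x y : riordan_near1 n x -> riordan_near1 n y ->
  [/\ riordan_near1 n (x * y)%g,
      rio_g (x * y)%g n.+1 = rio_g x n.+1 + rio_g y n.+1
    & rio_f (x * y)%g n.+2 = rio_f x n.+2 + rio_f y n.+2].
Proof.
move=> [gx fx] [gy fy].
have [gl _] := fps_comp_near_t (rio_g y) fx.
have [fl fn] := fps_comp_near_t (rio_f y) fx.
have gl1 i : (i <= n)%N -> fps_comp (rio_g y) (rio_f x) i = fps_one K i.
  by move=> lein; rewrite gl ?gy // ltnS ltnW.
have [ml mn] := fps_mul_near_one gx gl1.
split; first by split=> [|i lein] /=; rewrite ?fl ?fy.
- by rewrite /= mn gl.
(* The factor in front of [rio_f x n.+2] is the linear coefficient of [rio_f y], which is 1. *)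
- by rewrite /= fn (fy 1%N) // [X in X * _](_ : _ = 1) // mul1r addrC.
Qed.

Lemma riordan_near1X n k z : riordan_near1 n z ->
  [/\ riordan_near1 n (z ^+ k)%g,
      rio_g (z ^+ k)%g n.+1 = rio_g z n.+1 *+ k
    & rio_f (z ^+ k)%g n.+2 = rio_f z n.+2 *+ k].
Proof.
move=> zP; elim: k => [|k [IHk gk fk]]; first by rewrite expg0.
by have [] := riordan_near1M zP IHk; rewrite -expgS gk fk -!mulrS.
Qed.

Lemma riordan_torsion_free k z : [pchar K] =i pred0 -> riordan_near1 0 z ->
  (0 < k)%N -> (z ^+ k = 1)%g -> z = 1%g.
Proof.
move=> /pcharf0P char0 z0 k_gt0 zk.
have mulk_eq0 (u : K) : u *+ k = 0 -> u = 0.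
  by move/eqP; rewrite -mulr_natr mulf_eq0 char0 -leqn0 leqNgt k_gt0 orbF => /eqP.
have zn n : riordan_near1 n z.
  elim: n => // n IHn; have [_] := riordan_near1X k IHn.
  rewrite zk => /esym/mulk_eq0 gn /esym/mulk_eq0 fn; case: IHn => gl fl.
  by split=> i; rewrite leq_eqVlt => /predU1P[->//|]; [apply: gl | apply: fl].
by apply: riordan_eq; apply: funext => n; have [gn fn] := zn n; rewrite ?gn ?fn.
Qed.

Lemma riordan_mul_coef x y :
  rio_g (x * y)%g 0%N = rio_g x 0%N * rio_g y 0%N /\
  rio_f (x * y)%g 1%N = rio_f y 1%N * rio_f x 1%N.
Proof. by rewrite /= fps_mul0 fps_comp0 fps_comp1 //; apply/eqP/rio_f0. Qed.

(** Leading coefficients are compared in xy = yx[x,y] and cancelled, so no coefficient of an inverse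
    has to be computed. *)
Lemma riordan_commg_near1 x y : riordan_near1 0 [~ x, y]%g.
Proof.
have [gxy fxy] := riordan_mul_coef x y; have [gyx fyx] := riordan_mul_coef y x.
have [] := riordan_mul_coef (y * x)%g [~ x, y]%g.
rewrite -commgC gxy fxy gyx fyx.
rewrite [in LHS]mulrC -[LHS]mulr1 => /mulfI gc.
rewrite [in LHS]mulrC -[LHS]mul1r => /mulIf fc.
split=> [[|//] _|[|[|//]] _]; last 2 first.
- exact/eqP/rio_f0.
- by rewrite -fc // mulf_neq0 ?rio_f1.
- by rewrite -gc // mulf_neq0 ?rio_g0.
Qed.

Lemma riordan_embedding_abelian (gT : finGroupType)
    (phi : {multiplicative gT -> riordan K}) :
  [pchar K] =i pred0 -> injective phi -> abelian [set: gT].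
Proof.
move=> char0 phi_inj.
(* [phi] is only given as compatible with products; preservation of 1 follows by cancellation, and
   [psi] repackages [phi] so that the lemmas on commutators and powers apply. *)
have phi1 : phi 1%g = 1%g by apply: (mulgI (phi 1%g)); rewrite -gmulfM !mulg1.
pose phi_morph := isUMagmaMorphism.Build gT (riordan K) phi (phi1, gmulfM).
pose psi : UMagmaMorphism.type gT (riordan K) :=
  HB.pack (phi : gT -> riordan K) phi_morph.
apply/centsP => x _ y _; apply/commgP/eqP/phi_inj; rewrite phi1.
apply: (riordan_torsion_free char0) (order_gt0 [~ x, y]%g) _.
  by rewrite (gmulfR psi); apply: riordan_commg_near1.
by rewrite -(gmulfXn psi) expg_order.
Qed.

End FiniteSubgroups.

Section NonabelianGroups.
Local Open Scope group_scope.

Lemma Sym_nonabelian n : 3 <= n -> ~~ abelian [set: 'S_n].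
Proof.
case: n => [|[|[|n]]] // _; apply/negP => /centsP abS.
pose i k : 'I_n.+3 := inord k.
have iE k : k < 3 -> i k = k :> nat by move=> ltk; rewrite inordK // (leq_trans ltk).
have neq j k : j < 3 -> k < 3 -> (i j == i k) = (j == k).
  by move=> ltj ltk; rewrite -val_eqE /= !iE.
(* The transpositions (0 1) and (1 2) do not commute: depending on the order, 0 is sent to 2 or to
   1. *)
have := congr1 (fun s : 'S_n.+3 => s (i 0%N))
  (abS (tperm (i 0%N) (i 1%N)) (in_setT _) (tperm (i 1%N) (i 2%N)) (in_setT _)).
rewrite !permM tpermL tpermL [tperm _ _ (i 0%N)]tpermD ?neq // tpermL.
by move/eqP; rewrite neq.
Qed.

(** If y commutes with x and inverts it, then x^2 = 1, so the group generated by x and y has at most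
    4 elements, fewer than 2n. *)
Lemma dihedral_nonabelian n : 3 <= n -> ~~ abelian [set: 'D_(2 * n)].
Proof.
move=> n_ge3; have n_gt1 : 1 < n by apply: ltnW.
rewrite mul2n; apply/negP => abD.
(* The group is an image of itself, so its presentation provides the generators x and y. *)
have := homg_refl [set: 'D_n.*2]; rewrite (Grp_dihedral n_gt1).
case/existsP=> -[x y] /= /eqP[defD _ y2 xy].
have cxy : commute x y by apply: (centsP abD); rewrite inE.
have x2 : x ^+ 2 = 1 by rewrite expgS expg1 -{2}[x]invgK -xy conjgE cxy mulKg mulgV.
have o2 (z : 'D_n.*2) : z ^+ 2 = 1 -> #|<[z]>| <= 2.
  by move=> z2; apply: dvdn_leq => //; rewrite order_dvdn z2.
have := leq_pmulr #|<[x]> * <[y]>| (cardG_gt0 (<[x]> :&: <[y]>)).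
rewrite -mul_cardG -cent_joinEl ?cents_cycle // defD card_dihedral //.
move/leq_trans/(_ (leq_mul (o2 _ x2) (o2 _ y2))).
by rewrite -mul2n leq_pmul2l // leqNgt n_ge3.
Qed.

End NonabelianGroups.

Theorem corollary5 (R : realType) (n : nat) (hn : (3 <= n)%N) :
  ~ (exists phi : {multiplicative 'S_n -> riordan R[i]}, injective phi) /\
  ~ (exists phi : {multiplicative 'D_(2 * n) -> riordan R[i]}, injective phi).
Proof.
split=> -[phi phi_inj].
  by case/negP: (Sym_nonabelian hn);
    apply: riordan_embedding_abelian phi_inj; apply: pchar_num.
by case/negP: (dihedral_nonabelian hn);
  apply: riordan_embedding_abelian phi_inj; apply: pchar_num.
Qed.
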